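(* Let $b_w\ge 2$ be an integer, let $d$ be a power of two, and let $Q_w:\mathbb{R}^d\to\mathbb{R}^d$ be the $b_w$-bit symmetric uniform quantizer with clipping factor $1$ (as defined in the context). For any $\mathbf{w}\in\mathbb{R}^d$: (i) (no rotation) $$\|Q_w(\mathbf{w})-\mathbf{w}\|^2\le\frac{d\,\max_i\mathbf{w}_i^2}{4(2^{b_w-1}-1)^2}.$$ (ii) Let $\mathbf{R}(\zeta)=\mathbf{H}\,\mathrm{Diag}(\mathbf{r}(\zeta))$, where $\mathbf{H}\in\mathbb{R}^{d\times d}$ is the orthogonal (normalized) Walsh–Hadamard matrix and $\mathbf{r}(\zeta)$ is a uniformly random sign vector in $\{-1,1\}^d$. For any $\delta\in(0,1)$, with probability at least $1-\delta$, $$\|Q_w(\mathbf{R}(\zeta)\mathbf{w})-\mathbf{R}(\zeta)\mathbf{w}\|^2\le\frac{\log(4d/\delta)}{2(2^{b_w-1}-1)^2}\,\|\mathbf{w}\|^2.$$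
   Context: $\|\cdot\|$ is the Euclidean norm and $\log$ is the natural logarithm. Symmetric $b$-bit uniform quantizer with clipping factor $1$: for $\mathbf{X}\in\mathbb{R}^d$, $$Q(\mathbf{X})=s(\mathbf{X})\;\mathrm{clamp}_b\big(\lfloor\mathbf{X}/s(\mathbf{X})\rceil\big),\qquad s(\mathbf{X})=\frac{\max_i|\mathbf{X}_i|}{2^{b-1}-1},$$ where $\lfloor\cdot\rceil$ is element-wise rounding to a nearest integer and $\mathrm{clamp}_b(\mathbf{X})=\max\{-2^{b-1},\min\{\mathbf{X},2^{b-1}-1\}\}$ element-wise; $Q(\mathbf{0})=\mathbf{0}$. Normalized Walsh–Hadamard matrix: $\mathbf{H}=\mathbf{H}_d$ with $\mathbf{H}_1=(1)$ and $\mathbf{H}_{2m}=\frac{1}{\sqrt2}\begin{pmatrix}\mathbf{H}_m&\mathbf{H}_m\\ \mathbf{H}_m&-\mathbf{H}_m\end{pmatrix}$; its entries are $\pm 1/\sqrt d$ and $\mathbf{H}\mathbf{H}^\top=\mathbf{I}$. $\mathrm{Diag}(\mathbf{r})$ is the diagonal matrix with diagonal $\mathbf{r}$. A uniformly random sign vector has independent entries equal to $\pm1$ with probability $1/2$ each. *)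

(* Defs.v *)
From HB Require Import structures.
From mathcomp Require Import all_boot all_order all_algebra.
From mathcomp Require Import all_classical all_reals all_analysis.

Set Implicit Arguments.
Unset Strict Implicit.
Unset Printing Implicit Defensive.

Import Order.TTheory GRing.Theory Num.Theory.
Import numFieldNormedType.Exports.

Local Open Scope classical_set_scope.
Local Open Scope ring_scope.

(* Euclidean norm; MathComp-Analysis' own norm `|x| on matrices is the
   sup norm. *)
Definition l2norm (R : realType) (n : nat) (x : 'cV[R]_n) : R :=
  Num.sqrt (\sum_(i < n) x i 0 ^+ 2).

(* Rounding to a nearest integer; how ties are broken is left open. *)
Definition rounds_to_nearest (R : realType) (rnd : R -> int) : Prop :=
  forall (x : R) (z : int), `|x - (rnd x)%:~R| <= `|x - z%:~R|.

Definition clamp (b : nat) (z : int) : int :=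
  Order.max (- 2 ^+ b.-1) (Order.min z (2 ^+ b.-1 - 1)).

(* The initial value 0 of the maximum is harmless as the terms are >= 0. *)
Definition qscale (R : realType) (b n : nat) (X : 'cV[R]_n) : R :=
  (\big[Num.max/0]_(i < n) `|X i 0|) / (2 ^+ b.-1 - 1).

Definition quantizer (R : realType) (rnd : R -> int) (b n : nat)
    (X : 'cV[R]_n) : 'cV[R]_n :=
  if X == 0 then 0
  else qscale b X *:
       map_mx (fun x : R => (clamp b (rnd (x / qscale b X)))%:~R) X.

Lemma addn_exp2n (k : nat) : (2 ^ k + 2 ^ k = 2 ^ k.+1)%N.
Proof. by rewrite addnn -mul2n expnS. Qed.

(* hadamard R k is H_d for d = 2 ^ k. *)
Fixpoint hadamard (R : realType) (k : nat) : 'M[R]_(2 ^ k) :=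
  match k with
  | 0 => const_mx 1
  | k'.+1 =>
      let H := hadamard R k' in
      castmx (addn_exp2n k', addn_exp2n k')
        ((Num.sqrt 2)^-1 *: block_mx H H H (- H))
  end.

Definition mutually_independent (disp : measure_display)
    (T : measurableType disp) (R : realType) (P : probability T R) (n : nat)
    (X : 'I_n -> {RV P >-> R}) : Prop :=
  forall (J : {set 'I_n}) (B : 'I_n -> set R),
    (forall i, measurable (B i)) ->
    P [set t | forall i, i \in J -> B i (X i t)] =
    (\prod_(i in J) P (X i @^-1` B i))%E.

Definition uniform_sign_vector (disp : measure_display)
    (T : measurableType disp) (R : realType) (P : probability T R) (n : nat)
    (r : 'I_n -> {RV P >-> R}) : Prop :=
  [/\ forall i t, r i t = 1 \/ r i t = -1,
      forall i, P (r i @^-1` [set 1]) = (2^-1)%:E /\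
                P (r i @^-1` [set -1]) = (2^-1)%:E
    & mutually_independent r].

Definition rotation (disp : measure_display) (T : measurableType disp)
    (R : realType) (P : probability T R) (k : nat)
    (r : 'I_(2 ^ k) -> {RV P >-> R}) (t : T) : 'M[R]_(2 ^ k) :=
  hadamard R k *m diag_mx (\row_(i < 2 ^ k) r i t).

(* Main.v *)
(* Since max_i |X_i| / s(X) is the integer 2^(b-1) - 1, nearest rounding never
   leaves the clamping range, so every coordinate of Q(X) is off by at most
   s(X) / 2; summing the squares gives (i) for any vector X.  For (ii), each
   coordinate of the rotated vector is a Rademacher sum with squared weights
   adding up to |w|^2 / d, so Hoeffding's inequality (via cosh x <= exp (x^2/2))
   and a union bound give max_i y_i^2 <= 2 log(4d/delta) |w|^2 / d except with
   probability at most delta / 2, and (i) is applied to y.  The probabilities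
   are computed by counting sign patterns, which are equidistributed. *)
Require Import Defs.
From HB Require Import structures.
From mathcomp Require Import all_boot all_order all_algebra.
From mathcomp Require Import all_classical all_reals all_analysis ring lra.

Set Implicit Arguments.
Unset Strict Implicit.
Unset Printing Implicit Defensive.

Import Order.TTheory GRing.Theory Num.Theory.
Import numFieldNormedType.Exports.

Local Open Scope classical_set_scope.
Local Open Scope ring_scope.

(** * Exponential moments and tails of Rademacher sums *)

Lemma factX2_le m : (2 ^ m * m`! <= m.*2`!)%N.
Proof.
elim: m => [//|m IHm]; rewrite doubleS !factS expnS.
apply: (@leq_trans (m.*2.+2 * (2 ^ m * m`!))).
  by rewrite -doubleS -mul2n -!mulnA leq_mul2l /= mulnCA.
by rewrite leq_mul2l /= (leq_trans IHm) // leq_pmull.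
Qed.

(** Odd terms cancel, and the even term of index 2m is handled by [factX2_le]; [uphalf n] counts the
    even indices below [n]. *)
Lemma series_exp_coeff_even_le (R : realType) (x : R) n :
  series (exp_coeff x) n + series (exp_coeff (- x)) n
    <= 2 * series (exp_coeff (x ^+ 2 / 2)) (uphalf n).
Proof.
elim: n => [|n IHn]; first by rewrite /series /= !big_geq // addr0 mulr0.
rewrite 2!seriesSr addrACA (_ : uphalf n.+1 = n./2.+1) //.
case: (boolP (odd n)) => nodd; rewrite uphalf_half in IHn.
  rewrite nodd add1n in IHn; apply: le_trans IHn.
  rewrite /exp_coeff /= exprNn -signr_odd nodd expr1 mulN1r mulNr subrr addr0.
  exact: lexx.
have nE : n = n./2.*2 by rewrite even_halfK.
rewrite (negbTE nodd) add0n in IHn.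
rewrite seriesSr mulrDr lerD //.
rewrite /exp_coeff /= exprNn -signr_odd (negbTE nodd) expr0 mul1r.
rewrite -mulr2n -[leLHS]mulr_natl ler_wpM2l // {1 2}nE -mul2n exprM expr_div_n.
rewrite -mulrA ler_wpM2l ?(exprn_ge0 _ (sqr_ge0 x)) //.
rewrite -invfM lef_pV2 ?posrE ?mulr_gt0 ?exprn_gt0 ?ltr0n ?fact_gt0 //.
by rewrite -natrX -natrM ler_nat mul2n factX2_le.
Qed.

(** Limit of the comparison of partial sums; those on the right stay below their limit because the
    terms are nonnegative. *)
Lemma expR_sym_le (R : realType) (x : R) :
  expR x + expR (- x) <= 2 * expR (x ^+ 2 / 2).
Proof.
have cx := @is_cvg_series_exp_coeff R x.
have cNx := @is_cvg_series_exp_coeff R (- x).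
rewrite /expR -limD //; apply: limr_le; first exact: is_cvgD.
apply: nearW => n /=; apply: (le_trans (series_exp_coeff_even_le x n)).
rewrite ler_wpM2l //; apply: nondecreasing_cvgn_le; last first.
  exact: is_cvg_series_exp_coeff.
apply: nondecreasing_series => i _ _.
by rewrite exp_coeff_ge0 // divr_ge0 ?sqr_ge0.
Qed.

(** Each exponential is a product of one-sign factors, so the sum over all patterns factors into the
    [n] two-term sums bounded by [expR_sym_le]. *)
Lemma sum_expR_signs (R : realType) n (a : 'I_n -> R) :
  \sum_(s : {ffun 'I_n -> bool}) expR (\sum_i a i * (-1) ^+ s i)
    <= 2 ^+ n * expR ((\sum_i a i ^+ 2) / 2).
Proof.
under eq_bigr do rewrite expR_sum.
rewrite -(bigA_distr_bigA (fun i (b : bool) => expR (a i * (-1) ^+ b))).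
rewrite mulr_suml expR_sum -[X in _ ^+ X]card_ord -prodr_const -big_split /=.
apply: ler_prod => i _; rewrite big_bool /= expr1 expr0 mulr1 mulrN1 addrC.
by rewrite addr_ge0 ?expR_ge0 // expR_sym_le.
Qed.

(* Hoeffding's inequality for Rademacher sums, in counting form. *)
Lemma card_signs_gt (R : realType) n (a : 'I_n -> R) (L : R) : 0 <= L ->
  #|[pred s : {ffun 'I_n -> bool} |
      2 * L * (\sum_i a i ^+ 2) < (\sum_i a i * (-1) ^+ s i) ^+ 2]|%:R
    <= 2 ^+ n * (2 * expR (- L)) :> R.
Proof.
move=> L0; set V := \sum_i a i ^+ 2; set A := [pred s | _].
have V0 : 0 <= V by apply: sumr_ge0 => i _; rewrite sqr_ge0.
(* If [V] is 0, all weights vanish and the strict inequality leaves [A] empty; otherwise [V] may be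
   divided by. *)
have [VE|Vn0] := eqVneq V 0.
  rewrite (_ : #|_| = 0%N) ?mulr_ge0 ?exprn_ge0 ?expR_ge0 //.
  apply: eq_card0 => s; rewrite !inE VE mulr0 big1 ?expr0n ?ltxx // => i _.
  have /eqP : a i ^+ 2 = 0.
    by apply: (psumr_eq0P _ VE) => // j _; rewrite sqr_ge0.
  by rewrite sqrf_eq0 => /eqP ->; rewrite mul0r.
have Vp : 0 < V by rewrite lt_def Vn0.
set t := Num.sqrt (2 * L * V).
have t2 : t ^+ 2 = 2 * L * V by rewrite sqr_sqrtr // !mulr_ge0.
(* Chernoff parameter: it minimises l^2 V / 2 - l t, whose value is then -L. *)
pose l := t / V.
have l0 : 0 <= l by rewrite divr_ge0 ?sqrtr_ge0.
have lt : l * t = 2 * L by rewrite /l mulrAC -expr2 t2 mulfK.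
have l2 : l ^+ 2 * V / 2 = L by rewrite /l expr_div_n t2; field.
have sumE e : e ^+ 2 = l ^+ 2 ->
    \sum_(s : {ffun 'I_n -> bool}) expR (e * \sum_i a i * (-1) ^+ s i)
      <= 2 ^+ n * expR L.
  move=> eE; have -> : L = (\sum_i (e * a i) ^+ 2) / 2.
    by rewrite -l2 -eE mulr_sumr; under eq_bigr do rewrite -exprMn.
  under eq_bigr => s _.
    rewrite mulr_sumr; under eq_bigr do rewrite mulrA.
    over.
  exact: sum_expR_signs.
(* Markov's inequality for both tails at once: a pattern in [A] has |S| > t, so one of its two
   exponentials is at least exp (2L). *)
have key : #|A|%:R * expR (2 * L) <= 2 ^+ n * (2 * expR L).
  apply: (@le_trans _ _ (\sum_(s : {ffun 'I_n -> bool})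
     (expR (l * \sum_i a i * (-1) ^+ s i)
      + expR (- l * \sum_i a i * (-1) ^+ s i)))); last first.
    by rewrite big_split /= mulrCA mulr_natl mulr2n lerD // sumE // sqrrN.
  rewrite mulr_natl -sumr_const big_mkcond /=; apply: ler_sum => s _.
  case: ifP => [|_]; last by rewrite addr_ge0 ?expR_ge0.
  rewrite inE -t2; set S := \sum_i _ => tS.
  have {}tS : t < `|S|.
    by rewrite -(ltr_pXn2r (n := 2)) ?nnegrE ?sqrtr_ge0 // real_normK ?num_real.
  have {}tS : 2 * L <= l * `|S| by rewrite -lt ler_wpM2l // ltW.
  have [S0|S0] := leP 0 S.
    by rewrite ger0_norm // in tS; rewrite ler_wpDr ?expR_ge0 ?ler_expR.
  rewrite ltr0_norm // mulrN in tS.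
  by rewrite ler_wpDl ?expR_ge0 ?ler_expR // mulNr.
rewrite -(@ler_pM2r _ (expR (2 * L))) ?expR_gt0 //; apply: (le_trans key).
rewrite -!mulrA -expRD; rewrite (_ : - L + 2 * L = L) //; lra.
Qed.

(** * Rounding and quantization error *)

(** The distances from [x] to its floor and to the next integer add up to 1, so the smaller is at
    most 1/2. *)
Lemma rounds_to_nearest_half (R : realType) (rnd : R -> int) (x : R) :
  rounds_to_nearest rnd -> `|x - (rnd x)%:~R| <= 2^-1.
Proof.
move=> near; have /andP[lo hi] := floor_itv x.
have := near x (Num.floor x); have := near x (Num.floor x + 1).
rewrite intrD1 in hi *.
rewrite [X in _ <= X -> _]ler0_norm; last by lra.
rewrite [X in _ -> _ <= X -> _]ger0_norm; lra.
Qed.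

(** If the rounding exceeded [m], then [m], lying between it and [x], would be strictly closer. *)
Lemma rounds_to_nearest_le (R : realType) (rnd : R -> int) (x : R) (m : int) :
  rounds_to_nearest rnd -> x <= m%:~R -> (rnd x <= m)%R.
Proof.
move=> near xm; rewrite leNgt; apply/negP => mr.
have := near x m; apply/negP; rewrite -ltNge.
have mr' : m%:~R < (rnd x)%:~R :> R by rewrite ltr_int.
by rewrite !ler0_norm; lra.
Qed.

Lemma rounds_to_nearest_ge (R : realType) (rnd : R -> int) (x : R) (m : int) :
  rounds_to_nearest rnd -> m%:~R <= x -> (m <= rnd x)%R.
Proof.
move=> near xm; rewrite leNgt; apply/negP => mr.
have := near x m; apply/negP; rewrite -ltNge.
have mr' : (rnd x)%:~R < m%:~R :> R by rewrite ltr_int.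
by rewrite !ger0_norm; lra.
Qed.

Lemma clamp_rnd (R : realType) (rnd : R -> int) b (x : R) :
  rounds_to_nearest rnd -> `|x| <= 2 ^+ b.-1 - 1 -> clamp b (rnd x) = rnd x.
Proof.
move=> near; set m : int := 2 ^+ b.-1 - 1.
have -> : 2 ^+ b.-1 - 1 = m%:~R :> R by rewrite /m rmorphB rmorphXn.
rewrite ler_norml -rmorphN => /andP[lo hi].
have {}hi := rounds_to_nearest_le near hi.
have {}lo := rounds_to_nearest_ge near lo.
(* The clamping range is asymmetric: its lower end is -m - 1. *)
rewrite /clamp -/m min_l // max_r // (le_trans _ lo) // /m.
by rewrite opprB lerDr.
Qed.

Lemma l2norm_sqr (R : realType) n (x : 'cV[R]_n) :
  l2norm x ^+ 2 = \sum_i x i 0 ^+ 2.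
Proof. by rewrite sqr_sqrtr // sumr_ge0 // => i _; rewrite sqr_ge0. Qed.

Lemma quantizer_entry_error (R : realType) (rnd : R -> int) b n (X : 'cV[R]_n) i :
  rounds_to_nearest rnd -> (2 <= b)%N ->
  `|quantizer rnd b X i 0 - X i 0| <= qscale b X / 2.
Proof.
move=> near b2.
have M0 : 0 < 2 ^+ b.-1 - 1 :> R.
  by rewrite subr_gt0 exprn_egt1 // ?ltr1n // -lt0n -ltnS prednK // ltnW.
have Xle j : `|X j 0| <= qscale b X * (2 ^+ b.-1 - 1).
  by rewrite /qscale divfK ?gt_eqF // (le_bigmax _ (fun j => `|X j 0|)).
rewrite /quantizer; case: eqVneq => [X0|Xn0].
  rewrite X0 subrr normr0 divr_ge0 //.
  by rewrite -X0 -(pmulr_lge0 _ M0) (le_trans _ (Xle i)).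
have s0 : 0 < qscale b X.
  have [j Xj] : exists j, X j 0 != 0.
    by apply/existsP; apply: contra_neqT Xn0;
       rewrite negb_exists => /forallP X0; apply/matrixP => j c;
       rewrite ord1 mxE; apply/eqP/negbNE/X0.
  by rewrite -(pmulr_lgt0 _ M0) (lt_le_trans _ (Xle j)) ?normr_gt0.
rewrite !mxE clamp_rnd //; last first.
  by rewrite normrM normfV (gtr0_norm s0) ler_pdivrMr // mulrC.
set s := qscale b X in s0 *.
have s_neq0 : s != 0 by rewrite gt_eqF.
(* Writing [X i 0] as [s] times a quotient pulls the scale out and leaves a pure rounding error. *)
rewrite -{2}[X i 0](divfK s_neq0) [_ / s * s]mulrC -mulrBr normrM.
rewrite (gtr0_norm s0) ler_wpM2l ?(ltW s0) // distrC.
exact: rounds_to_nearest_half.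
Qed.

Lemma quantizer_error (R : realType) (rnd : R -> int) b n (X : 'cV[R]_n) :
  rounds_to_nearest rnd -> (2 <= b)%N ->
  l2norm (quantizer rnd b X - X) ^+ 2
    <= n%:R * (\big[Num.max/0]_(i < n) X i 0 ^+ 2)
       / (4 * (2 ^+ b.-1 - 1) ^+ 2).
Proof.
move=> near b2; rewrite l2norm_sqr; set m := \big[Num.max/0]_(i < n) _.
have m0 : 0 <= m by exact: bigmax_ge_id.
(* The scale uses the maximum of |X_i|, the claim that of X_i^2; the square root of [m] links
   them. *)
have qm : qscale b X ^+ 2 <= m / (2 ^+ b.-1 - 1) ^+ 2.
  rewrite expr_div_n ler_wpM2r ?invr_ge0 ?sqr_ge0 // -(sqr_sqrtr m0).
  rewrite ler_pXn2r ?nnegrE ?sqrtr_ge0 ?bigmax_ge_id //.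
  apply: bigmax_le => [|i _]; first exact: sqrtr_ge0.
  rewrite -sqrtr_sqr ler_sqrt //.
  exact: (le_bigmax _ (fun i => X i 0 ^+ 2)).
rewrite -mulrA mulr_natl -[X in _ *+ X]card_ord -sumr_const; apply: ler_sum => i _.
rewrite !mxE -real_normK ?num_real //.
apply: (@le_trans _ _ ((qscale b X / 2) ^+ 2)).
  by rewrite ler_pXn2r ?nnegrE ?(le_trans _ (quantizer_entry_error X i near b2))
             ?quantizer_entry_error.
rewrite [(4 * _)^-1]invfM mulrCA [leRHS]mulrC.
have -> : (qscale b X / 2) ^+ 2 = qscale b X ^+ 2 / 4 by field.
by rewrite ler_wpM2r ?invr_ge0.
Qed.

(** * Hadamard entries and equidistribution of sign patterns *)

(** Block signs disappear on squaring, and each doubling of the size contributes a factor 1/2. *)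
Lemma hadamard_sqr (R : realType) k i j :
  hadamard R k i j ^+ 2 = (2 ^ k)%:R^-1.
Proof.
elim: k i j => [|k IHk] i j; first by rewrite mxE expr1n expn0 invr1.
rewrite /= castmxE mxE exprMn exprVn sqr_sqrtr //.
have -> : (2 ^ k.+1)%:R^-1 = 2^-1 * (2 ^ k)%:R^-1 :> R.
  by rewrite expnS natrM invfM.
congr (_ * _).
rewrite !mxE; case: splitP => i' _; rewrite !mxE; case: splitP => j' _;
  by rewrite ?mxE ?sqrrN IHk.
Qed.

(** The bit [true] codes the sign -1. The event splits into disjoint cells, one per pattern, and
    independence gives each cell probability 2^-n. *)
Lemma prob_sign_pattern (disp : measure_display) (T : measurableType disp)
    (R : realType) (P : probability T R) n (r : 'I_n -> {RV P >-> R})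
    (q : pred {ffun 'I_n -> bool}) :
  uniform_sign_vector r ->
  P [set t | q [ffun i => r i t == -1]] = (#|q|%:R / 2 ^+ n)%:E.
Proof.
move=> [rpm rhalf rind].
pose A (s : {ffun 'I_n -> bool}) := [set t | [ffun i => r i t == -1] = s].
have N11 : (1 == -1 :> R) = false by rewrite eq_sym eqNr oner_eq0.
have AE s : A s = [set t | forall i, i \in [set: 'I_n]%SET ->
                      [set (-1) ^+ s i : R] (r i t)].
  apply/seteqP; split => t /= => [<- i _|rs].
    by rewrite ffunE; have [->|->] := rpm i t; rewrite ?N11 ?eqxx.
  apply/ffunP => i; rewrite ffunE rs ?inE //.
  by case: (s i); rewrite ?expr0 ?expr1 ?N11 ?eqxx.
have PA s : P (A s) = (2 ^- n)%:E.
  rewrite AE (rind _ (fun i => [set (-1) ^+ s i])) => [|i]; last first.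
    exact: measurable_set1.
  rewrite (eq_bigr (fun=> (2^-1)%:E)) => [|i _].
    by rewrite prodEFin prodr_const cardsT card_ord exprVn.
  by have [r1 rN1] := rhalf i; case: (s i); rewrite ?expr0 ?expr1.
have mA s : measurable (A s).
  rewrite (_ : A s = \bigcap_(i in [set: 'I_n]) r i @^-1` [set (-1) ^+ s i]).
    apply: fin_bigcap_measurable => [|i _]; first exact: finite_finset.
    by apply: measurable_funPTI; exact: measurable_set1.
  by rewrite AE; apply/seteqP; split => t /= rs i _;
    apply: rs; rewrite ?inE.
rewrite (_ : [set t | _] = \bigcup_(s in [set` q]) A s); last first.
  apply/seteqP; split => t /= => [qt|[s /= qs ts]]; last by rewrite ts.
  by eexists; first exact: qt.
rewrite measure_fin_bigcup //; last first.
  apply/trivIsetP => s s' _ _ /eqP ss'; apply/seteqP; split => t //.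
  by move=> [/= ts ts']; case: ss'; rewrite -ts -ts'.
rewrite -(@bigfs _ _ _ _ (index_enum {ffun 'I_n -> bool})) ?index_enum_uniq //.
  by rewrite (eq_bigr _ (fun s _ => PA s)) sumEFin sumr_const mulr_natl.
by move=> s _; rewrite mem_index_enum.
Qed.

(** Makes the rotation depend on the sign pattern alone, so that the event of (ii) can be
    counted. *)
Lemma rotation_signs (disp : measure_display) (T : measurableType disp)
    (R : realType) (P : probability T R) k (r : 'I_(2 ^ k) -> {RV P >-> R}) t :
  uniform_sign_vector r ->
  rotation r t = hadamard R k *m
    diag_mx (\row_i (-1) ^+ [ffun i => r i t == -1] i).
Proof.
move=> [rpm _ _]; congr (_ *m diag_mx _); apply/rowP => i; rewrite !mxE ffunE.
have [->|->] := rpm i t; last by rewrite eqxx.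
by rewrite eq_sym eqNr oner_eq0.
Qed.

Theorem proposition4p4 (R : realType) (bw : nat) (hbw : (2 <= bw)%N)
    (k : nat)
    (rnd : R -> int) (hrnd : rounds_to_nearest rnd)
    (w : 'cV[R]_(2 ^ k)) :
  (* (i) *)
  l2norm (quantizer rnd bw w - w) ^+ 2
    <= (2 ^ k)%N%:R * (\big[Num.max/0]_(i < 2 ^ k) w i 0 ^+ 2)
       / (4 * (2 ^+ bw.-1 - 1) ^+ 2)
  /\
  (* (ii) *)
  (forall (disp : measure_display) (Omega : measurableType disp)
          (P : probability Omega R) (r : 'I_(2 ^ k) -> {RV P >-> R}),
     uniform_sign_vector r ->
     forall delta : R, 0 < delta -> delta < 1 ->
     ((1 - delta)%:E <=
      P [set zeta | let y := (rotation r zeta *m w)%R in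
           (l2norm (quantizer rnd bw y - y) ^+ 2
             <= ln (4 * (2 ^ k)%N%:R / delta) / (2 * (2 ^+ bw.-1 - 1) ^+ 2)
                * l2norm w ^+ 2)%R])%E).
Proof.
split; first exact: quantizer_error.
move=> disp Omega P r unif delta d0 d1; set n := (2 ^ k)%N in w r unif *.
set L := ln _; pose H := hadamard R k.
pose Y (s : {ffun 'I_n -> bool}) := H *m diag_mx (\row_i (-1) ^+ s i) *m w.
pose q s := l2norm (quantizer rnd bw (Y s) - Y s) ^+ 2
              <= L / (2 * (2 ^+ bw.-1 - 1) ^+ 2) * l2norm w ^+ 2.
rewrite (_ : [set _ | _] = [set t | q [ffun i => r i t == -1]]); last first.
  by apply/seteqP; split => t /=; rewrite (rotation_signs t unif).
rewrite prob_sign_pattern // lee_fin.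
have n0 : 0 < n%:R :> R by rewrite ltr0n expn_gt0.
have n1 : 1 <= n%:R :> R by rewrite ler1n expn_gt0.
have arg0 : 0 < 4 * n%:R / delta :> R by rewrite divr_gt0 ?mulr_gt0.
(* The tail bound is applied with this [L]; the argument of the logarithm is at least 1 as delta < 1
   <= n. *)
have L0 : 0 <= L by rewrite ln_ge0 // ler_pdivlMr //; nra.
have expNL : expR (- L) = delta / (4 * n%:R).
  by rewrite expRN lnK ?posrE // invf_div.
pose bad i := [pred s : {ffun 'I_n -> bool} |
  2 * L * (\sum_j (H i j * w j 0) ^+ 2)
    < (\sum_j H i j * w j 0 * (-1) ^+ s j) ^+ 2].
have M0 : 0 < (2 ^+ bw.-1 - 1) ^+ 2 :> R.
  rewrite exprn_gt0 // subr_gt0 exprn_egt1 // ?ltr1n // -lt0n -ltnS.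
  by rewrite prednK // ltnW.
have YE s i : Y s i 0 = \sum_j H i j * w j 0 * (-1) ^+ s j.
  rewrite mxE; apply: eq_bigr => j _.
  by rewrite mul_mx_diag !mxE mulrAC.
have normE i : \sum_j (H i j * w j 0) ^+ 2 = l2norm w ^+ 2 / n%:R.
  rewrite l2norm_sqr mulr_suml; apply: eq_bigr => j _.
  by rewrite exprMn hadamard_sqr mulrC.
(* If no coordinate is bad, every squared coordinate is at most 2 L |w|^2 / n, and the factor n of
   (i) cancels. *)
have qbad s : ~~ q s -> [exists i, bad i s].
  apply: contraR; rewrite negb_exists => /forallP good.
  apply: (le_trans (quantizer_error _ hrnd hbw)).
  have max_le : \big[Num.max/0]_(i < n) Y s i 0 ^+ 2
      <= 2 * L * (l2norm w ^+ 2 / n%:R).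
    apply: bigmax_le => [|i _].
      by rewrite mulr_ge0 ?divr_ge0 ?sqr_ge0 ?(ltW n0) // mulr_ge0.
    by have := good i; rewrite /bad /= -leNgt normE YE.
  apply: (@le_trans _ _ (n%:R * (2 * L * (l2norm w ^+ 2 / n%:R))
                         / (4 * (2 ^+ bw.-1 - 1) ^+ 2))).
    rewrite ler_wpM2r ?invr_ge0 //; first by rewrite mulr_ge0 ?(ltW M0).
    by rewrite ler_wpM2l ?(ltW n0).
  move: M0; set M2 := _ ^+ 2 => M0.
  rewrite le_eqVlt; apply/orP; left; apply/eqP; field.
  by rewrite !gt_eqF.
have cardq : #|q|%:R + #|predC q|%:R = 2 ^+ n :> R.
  by rewrite -natrD cardC card_ffun card_bool card_ord natrX.
(* Union bound: each of the n coordinates is bad for at most 2^n * 2 * delta / (4n) patterns. *)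
have cardC_le : #|predC q|%:R <= 2 ^+ n * (delta / 2) :> R.
  apply: (@le_trans _ _ (\sum_(i < n) #|bad i|%:R)).
    rewrite -natr_sum ler_nat -sum1_card.
    under [leqRHS]eq_bigr do rewrite -sum1_card big_mkcond.
    rewrite exchange_big /= big_mkcond leq_sum // => s _.
    case: ifP => // /qbad/existsP[i si].
    by move: si; rewrite (bigD1 i) //= inE => ->.
  apply: (@le_trans _ _ (\sum_(i < n) 2 ^+ n * (2 * expR (- L)))).
    by apply: ler_sum => i _; exact: card_signs_gt.
  rewrite sumr_const card_ord -mulr_natl expNL le_eqVlt; apply/orP; left.
  by apply/eqP; field; rewrite gt_eqF.
(* The failing fraction is at most delta / 2, hence at most delta. *)
rewrite ler_pdivlMr ?exprn_gt0 //.
have : 0 < 2 ^+ n :> R by rewrite exprn_gt0.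
nra.
Qed.
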